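(* Let $X$ be an almost surely non-empty random closed convex set in $\mathfrak{X}$. Then $X$ is the intersection of an at most countable number of random half-spaces, that is, there exists a countable set $\{\zeta_n,n\geq1\}\subset\mathcal{L}^0(\mathfrak{X}^*,\mathcal{F})$ such that, almost surely, $$X=\bigcap_{n\geq1}\{x\in\mathfrak{X}:\ \langle\zeta_n,x\rangle\leq h_X(\zeta_n)\}.$$ If $X$ is weakly compact, then it is possible to let the $\zeta_n$ be deterministic elements from a countable total subset of $\mathfrak{X}^*$.
   Context: $\mathfrak{X}$ is a separable real Banach space with Borel $\sigma$-algebra $\mathcal{B}(\mathfrak{X})$; $(\Omega,\mathcal{F},\mathbf{P})$ is a complete probability space. A random set is a set-valued function $\omega\mapsto X(\omega)\subset\mathfrak{X}$ whose graph $\{(\omega,x):x\in X(\omega)\}$ belongs to $\mathcal{F}\otimes\mathcal{B}(\mathfrak{X})$; it is called closed, convex, weakly compact if $X(\omega)$ has this property for almost all $\omega$. $\mathfrak{X}^*$ is the dual space with pairing $\langle u,x\rangle$, equipped with the $\sigma(\mathfrak{X}^*,\mathfrak{X})$-topology and its Borel $\sigma$-algebra; $\zeta$ is a random element in $\mathfrak{X}^*$ if $\langle\zeta,x\rangle$ is a random variable for all $x\in\mathfrak{X}$, and $\mathcal{L}^0(\mathfrak{X}^*,\mathcal{F})$ is the family of all $\mathcal{F}$-measurable random elements in $\mathfrak{X}^*$. The support function is $h_X(u)=\sup\{\langle u,x\rangle:\ x\in X\}$, $u\in\mathfrak{X}^*$, with values in $[-\infty,\infty]$; $h_X(\zeta)$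 denotes $\omega\mapsto h_{X(\omega)}(\zeta(\omega))$. A subset of $\mathfrak{X}^*$ is total if it separates the points of $\mathfrak{X}$. *)

(* Defs.v *)
From HB Require Import structures.
From mathcomp Require Import all_boot all_order all_algebra.
From mathcomp Require Import all_classical all_reals all_analysis.

Set Implicit Arguments.
Unset Strict Implicit.
Unset Printing Implicit Defensive.

Import Order.TTheory GRing.Theory Num.Theory.
Import numFieldNormedType.Exports.

Local Open Scope classical_set_scope.
Local Open Scope ring_scope.

Definition separable (T : topologicalType) : Prop :=
  exists2 S : set T, countable S & dense S.

(* R^o is R seen as a module over itself, with its usual topology. *)
Record dual_space (R : realType) (E : normedModType R) : Type := Dual {
  dual_fun :> {linear E -> R^o};
  dual_continuous : continuous dual_fun }.

Definition total_set (R : realType) (E : normedModType R) (D : set (dual_space E)) : Prop :=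
  forall x y : E, x <> y -> exists2 u : dual_space E, D u & u x <> u y.

(* The topology sigma(E, E') on a copy of E: supremum over the dual of the initial
   topologies. *)
Definition weak_topology (R : realType) (E : normedModType R) : topologicalType :=
  sup_topology (fun u : dual_space E =>
    Topological.on (initial_topology (u : E -> R^o))).

Definition weakly_compact (R : realType) (E : normedModType R) (A : set E) : Prop :=
  compact (A : set (weak_topology E)).

Definition random_set (R : realType) (E : normedModType R) (d : measure_display)
    (Omega : measurableType d) (X : Omega -> set E) : Prop :=
  measurable ([set p | X p.1 p.2] : set (Omega * g_sigma_algebraType (@open E))).

(* Membership in L^0(E'): measurability is tested against each point of E. *)
Definition random_dual_element (R : realType) (E : normedModType R)
    (d : measure_display) (Omega : measurableType d)
    (zeta : Omega -> dual_space E) : Prop :=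
  forall x : E, measurable_fun [set: Omega] (fun w => zeta w x : R).

(* The value is -oo when A is empty. *)
Definition support_function (R : realType) (E : normedModType R) (A : set E)
    (u : dual_space E) : \bar R :=
  ereal_sup [set (u x : R)%:E | x in A].

(* Main.v *)
From HB Require Import structures.
Require Import Defs.
From mathcomp Require Import all_boot all_order all_algebra.
From mathcomp Require Import all_classical all_reals all_analysis.
From mathcomp Require Import measurable_realfun ring lra.
Import Order.TTheory GRing.Theory Num.Theory.
Import numFieldNormedType.Exports.

(** Random half-spaces. Fix a dense sequence e of points and let dist be the
    distance to the closed convex set X(w). A subgradient u of dist at e n has
    norm at most 1 and satisfies u c <= u (e n) - dist (e n) for all c in X(w),
    so the corresponding supporting half-space of X(w) excludes every point that
    is closer to e n than half its distance to X(w); these half-spaces, one for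
    each n, cut out X(w) ([closed_convex_halfspaces]).

    The subgradients have to depend measurably on w. They are obtained by an
    explicit form of the Hahn-Banach theorem: differentiating a convex function
    directionally at a point gives a sublinear function, and differentiating a
    sublinear function at v makes it linear along v ([dirderiv_sublinear],
    [dirderiv_chain_opp]). Doing this along e and passing to the infimum gives a
    continuous linear functional ([inf_chain_dual]). All infima involved reduce
    to countable ones, so the result is measurable in w as soon as dist x is,
    for each x ([measurable_subgrad]).

    The distance from x to X(w) is less than a if and only if w lies in the
    projection to Omega of a part of the graph of X, so its measurability is an
    instance of the measurable projection theorem ([measurable_projection]).
    Every set of the product sigma-algebra is obtained by the Suslin operation
    from rectangles with a closed second factor ([measurable_prod_suslin]);
    completeness of E turns its projection into a Suslin set over the measurable
    sets of Omega ([suslin_projection]), and completeness of P makes the latter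
    measurable ([suslin_measurable]).

    Weakly compact case. Let D be the set of rational combinations of a sequence
    f of functionals that separates points ([separating_sequence]). If X is
    weakly compact and convex and x is not in X, compactness shows that finitely
    many f i already distinguish x from every point of X; the image of X under
    these is convex and compact, so minimising the Euclidean distance to the
    image of x yields a strictly separating combination, whose coefficients can
    be perturbed to rational ones ([weakly_compact_rational_separation]). *)

Set Implicit Arguments.
Unset Strict Implicit.
Unset Printing Implicit Defensive.

Local Open Scope classical_set_scope.
Local Open Scope ring_scope.

(** * Linear functionals as iterated directional derivatives *)

Section ConvexFunctions.
Context (R : realType) (E : normedModType R).
Implicit Types (g p : E -> R) (x y z : E) (e : nat -> E) (C : set E).

Definition convex_nonexpansive g :=
  (forall x y (a b : R), 0 <= a -> 0 <= b -> a + b = 1 ->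
     g (a *: x + b *: y) <= a * g x + b * g y) /\
  (forall x y, g x - g y <= `|x - y|).

(** Homogeneity is required only for positive factors: this is what a one-sided
    directional derivative satisfies, and it already forces the value at the
    origin to vanish. *)
Definition sublinear_nonexpansive p :=
  [/\ forall x y, p (x + y) <= p x + p y,
      forall (s : R) x, 0 < s -> p (s *: x) = s * p x
    & forall x, p x <= `|x|].

Lemma sublinear0 p : sublinear_nonexpansive p -> p 0 = 0.
Proof.
case=> _ ph _; have := ph 2 0 (ltr0Sn _ 1); rewrite scaler0; lra.
Qed.

Lemma sublinear_ge_opp_norm p x : sublinear_nonexpansive p -> - `|x| <= p x.
Proof.
move=> sp; have [pa _ pn] := sp.
by have := pa x (- x); rewrite subrr sublinear0// -(normrN x); have := pn (- x); lra.
Qed.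

Lemma sublinear_convex p : sublinear_nonexpansive p -> convex_nonexpansive p.
Proof.
move=> sp; have [pa ph pn] := sp; split=> [x y a b a0 b0 _|x y]; last first.
  by have := pa (x - y) y; rewrite subrK; have := pn (x - y); lra.
have phw (s : R) z : 0 <= s -> p (s *: z) = s * p z.
  rewrite le_eqVlt => /orP[/eqP <-|/ph//].
  by rewrite scale0r mul0r sublinear0.
by apply: le_trans (pa _ _) _; rewrite !phw.
Qed.

(** For convex g the difference quotient is nondecreasing in s, so the infimum
    is the one-sided directional derivative of g at y in the direction x. Taking
    the infimum rather than a limit makes every inequality below a matter of
    choosing one good step. *)
Definition dirderiv g y x : R :=
  inf [set (g (y + s *: x) - g y) / s | s in [set s : R | 0 < s]].

Lemma dirderiv_lb g y x : convex_nonexpansive g ->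
  lbound [set (g (y + s *: x) - g y) / s | s in [set s : R | 0 < s]] (- `|x|).
Proof.
move=> [_ gl] _ [s /= s0 <-]; rewrite ler_pdivlMr//.
have := gl y (y + s *: x).
rewrite opprD addrA subrr sub0r normrN normrZ gtr0_norm// mulNr mulrC; lra.
Qed.

Lemma dirderiv_le g y x (s : R) : convex_nonexpansive g -> 0 < s ->
  dirderiv g y x <= (g (y + s *: x) - g y) / s.
Proof.
move=> cg s0; apply: ge_inf; last by exists s.
by exists (- `|x|); exact: dirderiv_lb.
Qed.

Lemma dirderiv_ge g y x (a : R) :
  (forall s : R, 0 < s -> a <= (g (y + s *: x) - g y) / s) -> a <= dirderiv g y x.
Proof.
move=> h; apply: lb_le_inf.
  by exists ((g (y + 1 *: x) - g y) / 1); exists 1 => //=; exact: ltr01.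
by move=> _ [s /= s0 <-]; exact: h.
Qed.

(** Differentiating a convex function at a point produces a sublinear function,
    to which the same operation can be applied again. *)
Lemma dirderiv_sublinear g y :
  convex_nonexpansive g -> sublinear_nonexpansive (dirderiv g y).
Proof.
move=> cg; have [gc gl] := cg; split=> [x x'|s x s0|x].
- (* with steps s for x and t for x', the step s t / (s + t) for x + x' makes
     y + s t / (s + t) (x + x') a convex combination of y + s x and y + t x' *)
  rewrite -lerBlDr; apply: dirderiv_ge => s s0.
  rewrite lerBlDr -lerBlDl; apply: dirderiv_ge => t t0.
  rewrite lerBlDl.
  have st0 : 0 < s + t by exact: addr_gt0.
  have w0 : 0 < s * t / (s + t) by rewrite divr_gt0// mulr_gt0.
  apply: le_trans (dirderiv_le y (x + x') cg w0) _.
  rewrite ler_pdivrMr//.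
  have ts1 : t / (s + t) + s / (s + t) = 1 by field; rewrite gt_eqF.
  have := gc (y + s *: x) (y + t *: x') _ _
    (divr_ge0 (ltW t0) (ltW st0)) (divr_ge0 (ltW s0) (ltW st0)) ts1.
  have -> : (t / (s + t)) *: (y + s *: x) + (s / (s + t)) *: (y + t *: x') =
      y + (s * t / (s + t)) *: (x + x').
    rewrite !scalerDr !scalerA addrACA -scalerDl.
    by rewrite ts1 scale1r; congr (_ + (_ *: _ + _ *: _)); field; rewrite gt_eqF.
  move/le_trans => h; rewrite lerBlDr; apply: h.
  rewrite le_eqVlt; apply/orP; left; apply/eqP; field.
  by rewrite !gt_eqF.
- apply/eqP; rewrite eq_le; apply/andP; split.
    rewrite mulrC -ler_pdivrMr//; apply: dirderiv_ge => t t0.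
    have ts0 : 0 < t / s by rewrite divr_gt0.
    rewrite ler_pdivrMr//; apply: le_trans (dirderiv_le _ _ cg ts0) _.
    rewrite scalerA divfK ?gt_eqF// le_eqVlt; apply/orP; left; apply/eqP; field.
    by rewrite !gt_eqF.
  apply: dirderiv_ge => t t0.
  have ts0 : 0 < t * s by rewrite mulr_gt0.
  rewrite mulrC -ler_pdivlMr//; apply: le_trans (dirderiv_le _ _ cg ts0) _.
  rewrite scalerA le_eqVlt; apply/orP; left; apply/eqP; field.
  by rewrite !gt_eqF.
- apply: le_trans (dirderiv_le _ _ cg ltr01) _.
  rewrite divr1 scale1r; apply: le_trans (gl _ _) _.
  by rewrite addrC addKr.
Qed.

(** The infimum over all positive steps can be computed on rational steps; this
    is what makes directional derivatives measurable in a parameter. *)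
Lemma dirderiv_lt_rat g y x (a : R) : convex_nonexpansive g ->
  dirderiv g y x < a <->
  exists q : rat, 0 < q /\ (g (y + ratr q *: x) - g y) / ratr q < a.
Proof.
move=> cg; split=> [Da|[q [q0 qa]]]; last first.
  by apply: le_lt_trans qa; apply: dirderiv_le => //; rewrite ltr0q.
have [s s0 sa] : exists2 s : R, 0 < s & (g (y + s *: x) - g y) / s < a.
  apply: contrapT => h; move: Da; apply/negP; rewrite -leNgt.
  apply: dirderiv_ge => s s0; rewrite leNgt; apply/negP => sa.
  by apply: h; exists s.
rewrite ltr_pdivrMr// in sa.
(* g (y + s x) - g y - a s is Lipschitz in s with constant |x| + |a|, so it
   remains negative on the interval from s to s + r *)
pose r := (a * s - (g (y + s *: x) - g y)) / (`|x| + `|a| + 1).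
have M0 : 0 < `|x| + `|a| + 1 by rewrite ltr_wpDl// addr_ge0.
have r0 : 0 < r by rewrite divr_gt0// subr_gt0.
have ssr : s < s + r by rewrite ltrDl.
have [q] := rat_in_itvoo ssr.
rewrite in_itv/= => /andP[sq qr].
have q0 : 0 < ratr q :> R by exact: lt_trans sq.
exists q; rewrite -(ltr0q R) q0; split=> //; rewrite ltr_pdivrMr//.
have [_ gl] := cg.
have := gl (y + ratr q *: x) (y + s *: x).
have -> : y + ratr q *: x - (y + s *: x) = (ratr q - s) *: x.
  by rewrite scalerBl opprD addrACA subrr add0r.
rewrite normrZ gtr0_norm ?subr_gt0// => h1.
have h2 : (ratr q - s) * (`|x| + `|a| + 1) < a * s - (g (y + s *: x) - g y).
  by rewrite -ltr_pdivlMr// -/r; lra.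
have h3 : - `|a| * (ratr q - s) <= a * (ratr q - s).
  apply: ler_wpM2r; first by rewrite subr_ge0 ltW.
  by rewrite lerNl -normrN ler_norm.
nra.
Qed.

(** Differentiating a sublinear function p at a point v gives a smaller
    sublinear function which takes opposite values at v and - v, so it is linear
    along v; further differentiation preserves this. Running through a dense
    sequence e leaves, in the limit, a linear functional below p. *)
Fixpoint dirderiv_chain e p n : E -> R :=
  if n is m.+1 then dirderiv (dirderiv_chain e p m) (e m) else p.

(** A subgradient of g at y, selected canonically by the sequence e. It is built
    from values of g by infima which reduce to countable ones, so that no
    measurable selection theorem is needed when g depends on a parameter. *)
Definition subgrad e g y x : R :=
  inf (range (fun n => dirderiv_chain e (dirderiv g y) n x)).

Section Subgradient.
Variables (e : nat -> E) (p : E -> R).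
Hypothesis sp : sublinear_nonexpansive p.

Lemma dirderiv_chain_sublinear n :
  sublinear_nonexpansive (dirderiv_chain e p n).
Proof.
by elim: n => [//|n ih]; apply: dirderiv_sublinear; exact: sublinear_convex.
Qed.

Lemma dirderiv_chainS_le n x :
  dirderiv_chain e p n.+1 x <= dirderiv_chain e p n x.
Proof.
have sn := dirderiv_chain_sublinear n; have [pa _ _] := sn.
apply: le_trans (dirderiv_le _ _ (sublinear_convex sn) ltr01) _.
by rewrite divr1 scale1r; have := pa (e n) x; lra.
Qed.

Lemma dirderiv_chain_noninc m n x : (m <= n)%N ->
  dirderiv_chain e p n x <= dirderiv_chain e p m x.
Proof.
elim: n => [|n ih]; first by rewrite leqn0 => /eqP ->.
rewrite leq_eqVlt => /orP[/eqP -> //|mn].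
by apply: le_trans (ih mn); exact: dirderiv_chainS_le.
Qed.

Lemma dirderiv_chain_opp n :
  dirderiv_chain e p n.+1 (- e n) <= - dirderiv_chain e p n (e n).
Proof.
have sn := dirderiv_chain_sublinear n.
apply: le_trans (dirderiv_le _ _ (sublinear_convex sn) ltr01) _.
by rewrite divr1 scale1r subrr sublinear0// sub0r.
Qed.

Let q x := inf (range (fun n => dirderiv_chain e p n x)).

Lemma inf_chain_le n x : q x <= dirderiv_chain e p n x.
Proof.
apply: ge_inf; last by exists n.
exists (- `|x|) => _ [m _ <-].
exact: sublinear_ge_opp_norm (dirderiv_chain_sublinear m).
Qed.

Lemma inf_chain_ge x a : (forall n, a <= dirderiv_chain e p n x) -> a <= q x.
Proof.
move=> h; apply: lb_le_inf; first by exists (dirderiv_chain e p 0 x), 0%N.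
by move=> _ [m _ <-].
Qed.

Lemma inf_chain_sublinear : sublinear_nonexpansive q.
Proof.
split=> [x y|s x s0|x].
- rewrite -lerBlDr; apply: inf_chain_ge => m.
  rewrite lerBlDr -lerBlDl; apply: inf_chain_ge => n.
  rewrite lerBlDr.
  have [pa _ _] := dirderiv_chain_sublinear (maxn m n).
  apply: le_trans (inf_chain_le (maxn m n) _) _.
  apply: le_trans (pa _ _) _; rewrite addrC.
  by apply: lerD; apply: dirderiv_chain_noninc; rewrite ?leq_maxl ?leq_maxr.
- apply/eqP; rewrite eq_le; apply/andP; split.
    rewrite mulrC -ler_pdivrMr//; apply: inf_chain_ge => n.
    have [_ ph _] := dirderiv_chain_sublinear n.
    by rewrite ler_pdivrMr// mulrC -ph//; exact: inf_chain_le.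
  apply: inf_chain_ge => n; have [_ ph _] := dirderiv_chain_sublinear n.
  by rewrite ph// ler_pM2l//; exact: inf_chain_le.
- by apply: le_trans (inf_chain_le 0 x) _; have [_ _] := sp.
Qed.

Hypothesis e_dense : forall x (r : R), 0 < r -> exists n, `|x - e n| < r.

(** The set where q (- x) = - q x is closed, since q is nonexpansive, and it
    contains every e n, because the derivative taken at e n is linear along e n. *)
Lemma inf_chain_opp x : q (- x) = - q x.
Proof.
have sq := inf_chain_sublinear; have [qa _ qn] := sq.
apply/eqP; rewrite eq_le; apply/andP; split; last first.
  by have := qa x (- x); rewrite subrr sublinear0//; lra.
apply/ler_addgt0Pr => r r0.
have [n en] := e_dense x (divr_gt0 r0 (ltr0Sn _ 1) : 0 < r / 2).
have h1 := inf_chain_le n (e n).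
have h2 := le_trans (inf_chain_le n.+1 (- e n)) (dirderiv_chain_opp n).
have h3 := qa (e n) (x - e n); rewrite addrC subrK in h3.
have h4 := qa (- e n) (- (x - e n)).
rewrite opprB addrA addNr sub0r -opprB in h4.
have := qn (x - e n); have := qn (- (x - e n)); rewrite normrN.
lra.
Qed.

Lemma inf_chain_dual : exists u : dual_space E, forall x, u x = q x.
Proof.
have sq := inf_chain_sublinear; have [qa qh qn] := sq.
have qlin : linear (q : E -> R^o).
  move=> a x y.
  have add z t : q (z + t) = q z + q t.
    apply/eqP; rewrite eq_le qa/=.
    by have := qa (- z) (- t); rewrite -opprD !inf_chain_opp; lra.
  rewrite add; congr (_ + _); have [a0|a0|->] := ltgtP a 0.
  - rewrite -[a]opprK scaleNr inf_chain_opp qh ?oppr_gt0//.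
    by rewrite mulNr !opprK.
  - exact: qh.
  - by rewrite !scale0r sublinear0.
pose f := @GRing.isLinear.Build R E R^o *:%R q qlin.
pose fL : {linear E -> R^o} := HB.pack (q : E -> R^o) f.
have fc : continuous fL.
  apply: bounded_linear_continuous; apply/linear_boundedP.
  near=> M; move=> x.
  have M1 : 1 <= M by near: M; apply: nbhs_pinfty_ge; rewrite num_real.
  apply: (@le_trans _ _ `|x|); last by rewrite ler_peMl.
  by rewrite (@ler_norml R); apply/andP; split; [exact: sublinear_ge_opp_norm|exact: qn].
by exists (Dual fc).
Unshelve. all: by end_near.
Qed.
End Subgradient.
End ConvexFunctions.

(** * Supporting half-spaces of closed convex sets *)

Section Distance.
Context (R : realType) (E : normedModType R).
Implicit Types (g p : E -> R) (x y z : E) (e : nat -> E) (C : set E).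

Lemma subgrad_dual e g y :
  (forall x (r : R), 0 < r -> exists n, `|x - e n| < r) ->
  convex_nonexpansive g ->
  exists u : dual_space E, forall x, u x = subgrad e g y x.
Proof. by move=> ed cg; apply: inf_chain_dual => //; exact: dirderiv_sublinear. Qed.

(** This is the subgradient inequality; in particular u (c - y) <= g c - g y at
    every point c. *)
Lemma subgrad_le e g y x : convex_nonexpansive g ->
  subgrad e g y x <= g (y + x) - g y.
Proof.
move=> cg; apply: le_trans (inf_chain_le _ (dirderiv_sublinear y cg) 0 x) _.
by have := dirderiv_le y x cg ltr01; rewrite divr1 scale1r.
Qed.

Definition dist C x : R := inf [set `|x - c| | c in C].

Lemma dist_le C x c : C c -> dist C x <= `|x - c|.
Proof.
move=> Cc; apply: ge_inf; last by exists c.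
by exists 0 => _ [z _ <-].
Qed.

Lemma dist_ltP C x (r : R) : C !=set0 ->
  dist C x < r <-> exists2 c, C c & `|x - c| < r.
Proof.
move=> [c0 Cc0]; split=> [d|[c Cc xc]]; last exact: le_lt_trans (dist_le x Cc) xc.
apply: contrapT => h; move: d; apply/negP; rewrite -leNgt.
apply: lb_le_inf; first by exists `|x - c0|, c0.
by move=> _ [c Cc <-]; rewrite leNgt; apply/negP => xc; apply: h; exists c.
Qed.

Lemma dist_convex_nonexpansive C : C !=set0 ->
  convex_set (C : set (convex_lmodType E)) -> convex_nonexpansive (dist C).
Proof.
move=> C0 cC; split=> [x y a b a0 b0 ab1|x y].
- apply/ler_addgt0Pr => r r0.
  have [c Cc xc] := (dist_ltP x (dist C x + r) C0).1 ltac:(by rewrite ltrDl).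
  have [c' Cc' yc] := (dist_ltP y (dist C y + r) C0).1 ltac:(by rewrite ltrDl).
  have Cab : C (a *: c + b *: c').
    have a1 : a <= 1 by rewrite -ab1 lerDl.
    have := cC c c' (Itv01 a0 a1); rewrite !inE => /(_ Cc Cc').
    by have -> : b = 1 - a by rewrite -ab1 addrC addKr.
  apply: le_trans (dist_le _ Cab) _.
  have -> : a *: x + b *: y - (a *: c + b *: c') = a *: (x - c) + b *: (y - c').
    by rewrite opprD addrACA !scalerBr.
  apply: le_trans (ler_normD _ _) _; rewrite !normrZ !ger0_norm//.
  have -> : a * dist C x + b * dist C y + r = a * (dist C x + r) + b * (dist C y + r).
    by rewrite !mulrDr addrACA -mulrDl ab1 mul1r.
  by apply: lerD; apply: ler_wpM2l => //; exact: ltW.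
- apply/ler_addgt0Pr => r r0.
  have [c Cc yc] := (dist_ltP y (dist C y + r) C0).1 ltac:(by rewrite ltrDl).
  have := dist_le x Cc; have := ler_normD (x - y) (y - c).
  by rewrite addrA subrK; lra.
Qed.

Lemma dist_gt0 C x : C !=set0 -> closed C -> ~ C x -> 0 < dist C x.
Proof.
move=> C0 cC Cx; have : nbhs x (~` C).
  by apply: open_nbhs_nbhs; split=> //; exact: closed_openC.
move=> /nbhs_normP[r /= r0 h]; apply: lt_le_trans r0 _.
rewrite leNgt; apply/negP => /(dist_ltP _ _ C0)[c Cc xc].
by have := h c; rewrite /= => /(_ xc).
Qed.

(** A subgradient u n of the distance to C at e n satisfies u n c <= u n (e n) -
    dist C (e n) for all c in C, because the distance vanishes on C. Since u n
    has norm at most 1, a point x outside C violates the n-th inequality as soon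
    as e n is closer to x than half the distance from x to C. *)
Lemma closed_convex_halfspaces C e (u : nat -> dual_space E) :
  (forall x (r : R), 0 < r -> exists n, `|x - e n| < r) ->
  C !=set0 -> closed C -> convex_set (C : set (convex_lmodType E)) ->
  (forall n x, u n x = subgrad e (dist C) (e n) x) ->
  C = \bigcap_n [set x : E | ((u n x : R)%:E <= support_function C (u n))%E].
Proof.
move=> ed C0 cC vC uE; have cd := dist_convex_nonexpansive C0 vC.
apply/seteqP; split=> [x Cx n _|x Hx] /=; first by apply: ereal_sup_ubound; exists x.
apply: contrapT => Cx; have d0 := dist_gt0 C0 cC Cx.
have [n xn] := ed x _ (divr_gt0 d0 (ltr0Sn _ 1) : 0 < dist C x / 2).
have ub c : C c -> u n c <= u n (e n) - dist C (e n).
  move=> Cc; have := subgrad_le e (e n) (c - e n) cd.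
  rewrite -uE linearB/= (addrC (e n)) subrK.
  have : dist C c <= 0 by have := dist_le c Cc; rewrite subrr normr0.
  lra.
have : (support_function C (u n) <= (u n (e n) - dist C (e n))%:E)%E.
  by apply: ge_ereal_sup => _ [c Cc <-]; rewrite lee_fin; exact: ub.
move=> /(le_trans (Hx n I)); rewrite lee_fin.
have := subgrad_le e (e n) (e n - x) cd; rewrite -uE linearB/=.
have [_ dl] := cd.
have := dl x (e n); have := dl (e n + (e n - x)) (e n).
rewrite addrAC subrr add0r (distrC (e n) x).
move: xn; lra.
Qed.

End Distance.

(** * Measurability of subgradients *)

Section MeasurableSubgradient.
Context (R : realType) (E : normedModType R) (d : measure_display)
  (Omega : measurableType d).

Lemma measurable_fun_lt_ray (f : Omega -> R) :
  (forall a, measurable [set w | f w < a]) -> measurable_fun setT f.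
Proof.
move=> h mD; apply: (measurability _ (RGenInftyO.measurableE R)) => //.
move=> /= _ [_ [x ->] <-]; rewrite setTI.
rewrite (_ : _ @^-1` _ = [set w | f w < x])//.
Qed.

Lemma measurable_lt_ray (f : Omega -> R) a :
  measurable_fun setT f -> measurable [set w | f w < a].
Proof.
move=> mf; have := mf measurableT _ (measurable_itv `]-oo, a[); rewrite setTI.
rewrite (_ : _ @^-1` _ = [set w | f w < a])//.
Qed.

Lemma measurable_dirderiv (g : Omega -> E -> R) y x :
  (forall w, convex_nonexpansive (g w)) ->
  (forall x, measurable_fun setT (g^~ x)) ->
  measurable_fun setT (fun w => dirderiv (g w) y x).
Proof.
move=> cg mg; apply: measurable_fun_lt_ray => a.
rewrite (_ : [set w | _] = \bigcup_(q in [set q : rat | 0 < q])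
   [set w | (g w (y + ratr q *: x) - g w y) / ratr q < a]); last first.
  apply/seteqP; split=> w /=.
    by move=> /(dirderiv_lt_rat _ _ _ (cg w))[q [q0 h]]; exists q.
  by move=> [q q0 h]; apply/(dirderiv_lt_rat _ _ _ (cg w)); exists q.
rewrite bigcup_mkcond; apply: bigcupT_measurable_rat => q.
case: ifP => // _; apply: measurable_lt_ray.
by apply: measurable_funM => //; apply: measurable_funB.
Qed.

Lemma measurable_subgrad (e : nat -> E) (g : Omega -> E -> R) y x :
  (forall w, convex_nonexpansive (g w)) ->
  (forall x, measurable_fun setT (g^~ x)) ->
  measurable_fun setT (fun w => subgrad e (g w) y x).
Proof.
move=> cg mg.
have sg w := dirderiv_sublinear y (cg w).
have mc n : forall x, measurable_fun setT
    (fun w => dirderiv_chain e (dirderiv (g w) y) n x).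
  elim: n => [|n ih] z /=; first exact: measurable_dirderiv.
  apply: measurable_dirderiv => // w.
  exact: sublinear_convex (dirderiv_chain_sublinear _ (sg w) n).
apply: measurable_fun_lt_ray => a.
rewrite (_ : [set w | _] = \bigcup_n
   [set w | dirderiv_chain e (dirderiv (g w) y) n x < a]); last first.
  apply/seteqP; split=> w /=.
    move=> h; apply: contrapT => H; move: h; apply/negP; rewrite -leNgt.
    apply: inf_chain_ge => n; rewrite leNgt; apply/negP => h.
    by apply: H; exists n.
  by move=> [n _ h]; apply: le_lt_trans h; exact: inf_chain_le.
by apply: bigcup_measurable => n _; exact: measurable_lt_ray.
Qed.

End MeasurableSubgradient.

(** * The Suslin operation on abstract sets *)

Section Suslin.
Context (T : Type).
Implicit Types (G : set (set T)) (B : set T) (s t : nat -> nat).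

(** Continuity, uniform over all sequences, for the discrete topology on the
    values. *)
Definition finitely_determined (A : Type) (f : (nat -> nat) -> A) :=
  exists N, forall s t, (forall j, (j < N)%N -> s j = t j) -> f s = f t.

(** The Suslin operation. The usual scheme indexes sets of G by the prefixes of
    s; here the n-th set may depend on any finite number of terms of s, which
    makes the closure properties immediate, as several sequences can be
    interleaved into one without keeping track of positions. *)
Definition suslin G B := exists S : nat -> (nat -> nat) -> set T,
  [/\ forall n s, G (S n s), forall n, finitely_determined (S n)
    & B = [set p | exists s, forall n, S n s p]].

Definition unpair (n : nat) : nat * nat := odflt (0%N, 0%N) (unpickle n).

Lemma unpairK i j : unpair (pickle (i, j)) = (i, j).
Proof. by rewrite /unpair pickleK. Qed.

Lemma suslin_self G B : G B -> suslin G B.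
Proof.
move=> GB; exists (fun _ _ => B); split=> //.
  by move=> n; exists 0%N.
by apply/seteqP; split=> p /=; [exists id|case=> _ /(_ 0%N)].
Qed.

(** One sequence t codes a witness for each B i, namely its terms of indices
    pickle (i, j); the conditions of all the B i are enumerated together. *)
Lemma suslin_bigcap G (B : nat -> set T) :
  (forall i, suslin G (B i)) -> suslin G (\bigcap_i B i).
Proof.
move=> /choice[S hS].
exists (fun k t => S (unpair k).1 (unpair k).2 (fun j => t (pickle ((unpair k).1, j)))).
split=> [k t|k|].
- by have [h _ _] := hS (unpair k).1.
- have [_ /(_ (unpair k).2)[N hN] _] := hS (unpair k).1.
  exists (\max_(j < N) (pickle ((unpair k).1, j : nat))).+1 => s t st.
  apply: hN => j jN; apply: st; rewrite ltnS.
  exact: (@leq_bigmax _ (fun j : 'I_N => pickle ((unpair k).1, j : nat)) (Ordinal jN)).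
- apply/seteqP; split=> p /=; last first.
    move=> [t ht] i _; have [_ _ ->] := hS i.
    exists (fun j => t (pickle (i, j))) => n.
    by have := ht (pickle (i, n)); rewrite unpairK.
  move=> Bp; have : forall i, exists s, forall n, S i n s p.
    by move=> i; have := Bp i I; have [_ _ ->] := hS i.
  move=> /choice[s hs]; exists (fun k => s (unpair k).1 (unpair k).2) => k.
  rewrite (_ : (fun j => _) = s (unpair k).1) ?hs//.
  by apply/funext => j; rewrite unpairK.
Qed.

(** The first term of the sequence chooses the index i, the other terms are a
    witness for B i. *)
Lemma suslin_bigcup G (B : nat -> set T) : G setT ->
  (forall i, suslin G (B i)) -> suslin G (\bigcup_i B i).
Proof.
move=> GT /choice[S hS].
exists (fun k t => if t 0%N == (unpair k).1
  then S (unpair k).1 (unpair k).2 (fun j => t j.+1) else setT).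
split=> [k t|k|].
- by case: ifP => // _; have [h _ _] := hS (unpair k).1.
- have [_ /(_ (unpair k).2)[N hN] _] := hS (unpair k).1.
  exists N.+1 => s t st; rewrite st//; case: ifP => // _.
  by apply: hN => j jN; exact: st.
- apply/seteqP; split=> p /=.
    move=> [i _]; have [_ _ ->] := hS i => -[s hs].
    exists (fun j => if j is j'.+1 then s j' else i) => k /=.
    by case: eqP => // <-.
  move=> [t ht]; exists (t 0%N) => //; have [_ _ ->] := hS (t 0%N).
  exists (fun j => t j.+1) => n.
  by have := ht (pickle (t 0%N, n)); rewrite unpairK eqxx.
Qed.

(** Suslin sets are in general not closed under complement, whence the symmetric
    condition. *)
Lemma sigma_algebra_bisuslin G : G set0 -> G setT ->
  sigma_algebra setT [set B | suslin G B /\ suslin G (~` B)].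
Proof.
move=> G0 GT; split=> [|A [SA SCA]|A hA] /=.
- by rewrite setC0; split; exact: suslin_self.
- by rewrite setTD setCK.
- split; first by apply: suslin_bigcup => // i; have [] := hA i.
  by rewrite setC_bigcup; apply: suslin_bigcap => i; have [] := hA i.
Qed.

End Suslin.

(** * Suslin sets in a complete probability space *)

Section Completeness.
Context (R : realType) (d : measure_display) (Omega : measurableType d)
  (P : probability Omega R).

(** A countable intersection of measurable supersets whose measures approach the
    infimum; a smaller measurable superset cannot lose mass. *)
Lemma measurable_hull (A : set Omega) : exists H,
  [/\ measurable H, A `<=` H
    & forall D, measurable D -> A `<=` D -> P (H `\` D) = 0%E].
Proof.
pose c := ereal_inf [set P F | F in [set F | measurable F /\ A `<=` F]].
have c_le F : measurable F -> A `<=` F -> (c <= P F)%E.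
  by move=> mF AF; apply: ereal_inf_lbound; exists F.
have cfin : c \is a fin_num.
  apply/fin_numPlt/andP; split.
    apply: (@lt_le_trans _ _ 0%E); first exact: ltNy0.
    by apply: le_ereal_inf_tmp => _ [F _ <-].
  apply: le_lt_trans (c_le _ measurableT (@subsetT _ _)) _.
  by rewrite probability_setT ltry.
have : forall n : nat, exists F,
    [/\ measurable F, A `<=` F & (P F < c + n.+1%:R^-1%:E)%E].
  move=> n; have n0 : (0 < n.+1%:R^-1 :> R)%R by rewrite invr_gt0.
  by have [_ [F [mF AF] <-] h] := lb_ereal_inf_adherent n0 cfin; exists F.
move=> /choice[F hF]; exists (\bigcap_n F n); split.
- by apply: bigcapT_measurable => n; have [] := hF n.
- by move=> w Aw n _; have [_ h _] := hF n; exact: h.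
- move=> D mD AD; set H := \bigcap_n F n.
  have mH : measurable H by apply: bigcapT_measurable => n; have [] := hF n.
  have AH : A `<=` H by move=> w Aw n _; have [_ h _] := hF n; exact: h.
  have PHc : (P H <= c)%E.
    apply/lee_addgt0Pr => r r0.
    have [n nr] : exists n : nat, n.+1%:R^-1 < r.
      have [n _ h] := near_infty_natSinv_lt (PosNum r0).
      by exists n; exact: (h n (leqnn n)).
    have [mF _ h] := hF n; apply: (@le_trans _ _ (P (F n))).
      by apply: le_measure; rewrite ?inE// => w; apply.
    by apply: le_trans (ltW h) _; rewrite leeD2l// lee_fin ltW.
  have PHD : P H = (P (H `\` D) + P (H `&` D))%E by rewrite -measureDI.
  have h : (c <= P (H `&` D))%E.
    by apply: c_le; [exact: measurableI|move=> w Aw; split; [exact: AH|exact: AD]].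
  have fHD : P (H `&` D) \is a fin_num by apply: fin_num_measure; exact: measurableI.
  apply/eqP; rewrite eq_le measure_ge0 andbT.
  by rewrite -(leeD2rE _ _ fHD) add0e -PHD; exact: le_trans h.
Qed.

Hypothesis P_complete : measure_is_complete P.

(** Marczewski's argument. For a finite prefix l let K l be a measurable hull of
    the set Bs l of points having a witness that extends l, cut down by the
    conditions that l decides. As Bs l is the union of the Bs (rcons l i), the
    set K l exceeds the union of the K (rcons l i) by a null set Z l only.
    Outside the countably many Z l, a point of K [::] can be followed through
    longer and longer prefixes, which gives a witness for it: B and K [::] differ
    by a null set. *)
Lemma suslin_measurable (B : set Omega) : suslin measurable B -> measurable B.
Proof.
move=> [S [mS /choice[N hN] BE]].
pose Bs (l : seq nat) := [set w | exists s : nat -> nat,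
  (forall j, (j < size l)%N -> s j = nth 0%N l j) /\ forall n, S n s w].
have /choice[h hh] := fun l => measurable_hull (Bs l).
pose K l := h l `&` \bigcap_(n in [set n | (N n <= size l)%N]) S n (nth 0%N l).
have mK l : measurable (K l).
  apply: measurableI; first by have [] := hh l.
  by apply: bigcap_measurableType => n _; exact: mS.
have BK l : Bs l `<=` K l.
  move=> w Bw; split; first by have [_ /(_ w Bw)] := hh l.
  move=> n /= nl; have [s [sl Ss]] := Bw.
  rewrite -(hN n s)// => j jN; apply: sl; exact: leq_trans nl.
pose Z l := K l `\` \bigcup_i K (rcons l i).
have mZ l : measurable (Z l).
  by apply: measurableD => //; exact: bigcupT_measurable.
have Z0 l : P (Z l) = 0%E.
  have [mh _ h0] := hh l; set D := \bigcup_i K (rcons l i).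
  have mD : measurable D by exact: bigcupT_measurable.
  apply/eqP; rewrite eq_le measure_ge0 andbT -(h0 D)//.
    by apply: le_measure; rewrite ?inE//; [exact: measurableD|move=> w [[? _] ?]].
  move=> w [s [sl Ss]]; exists (s (size l)) => //; apply: BK.
  exists s; split=> // j; rewrite size_rcons ltnS leq_eqVlt nth_rcons.
  by case: ltngtP => //= [jl _|-> _]; [exact: sl|].
have KB : K [::] `\` B `<=` \bigcup_k Z (odflt [::] (unpickle k)).
  move=> w [K0 nB]; apply: contrapT => nZ; apply: nB.
  have step l : exists i, K l w -> K (rcons l i) w.
    have [Kl|nK] := pselect (K l w); last by exists 0%N.
    apply: contrapT => nex; apply: nZ; exists (pickle l) => //.
    by rewrite pickleK /=; split=> // -[i _ Ki]; apply: nex; exists i.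
  have [f hf] := choice step.
  pose t := fix t n := if n is m.+1 then rcons (t m) (f (t m)) else [::].
  have tK n : K (t n) w by elim: n => //= n ih; exact: hf.
  have st n : size (t n) = n by elim: n => //= n ih; rewrite size_rcons ih.
  have nt n j : (j < n)%N -> nth 0%N (t n) j = f (t j).
    elim: n => //= n ih; rewrite ltnS leq_eqVlt nth_rcons st.
    by case: ltngtP => //= [jn _|-> _]; [exact: ih|].
  rewrite BE; exists (fun n => f (t n)) => n.
  have [_ /(_ n)] := tK (N n); rewrite /= st => /(_ (leqnn _)).
  by rewrite (hN n _ (fun n => f (t n)))// => j; exact: nt.
have -> : B = K [::] `\` (K [::] `\` B).
  rewrite setDD; apply/seteqP; split=> w; last by case.
  move=> Bw; split=> //; apply: BK; move: Bw; rewrite {1}BE => -[s Ss].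
  by exists s.
apply: measurableD => //; apply: P_complete.
apply: (negligibleS KB); apply: negligible_bigcup => k.
by apply/negligibleP; [exact: mZ|exact: Z0].
Qed.

End Completeness.

(** * Measurable projection along a Polish space *)

Section Projection.
Context (R : realType) (E : completeNormedModType R) (d : measure_display)
  (Omega : measurableType d).

Definition closed_rectangles : set (set (Omega * E)) :=
  [set M | exists (A : set Omega) (C : set E),
    [/\ measurable A, closed C & M = A `*` C]].

Lemma closed_rectangle (A : set Omega) (C : set E) :
  measurable A -> closed C -> closed_rectangles (A `*` C).
Proof. by move=> mA cC; exists A, C. Qed.

(** An open set is the increasing union of the closed sets of those points whose
    distance to the complement is at least 1 / (n + 1). *)
Lemma suslin_open_cylinder (U : set E) : open U ->
  suslin closed_rectangles (setT `*` U).
Proof.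
move=> oU.
pose C n := ~` \bigcup_(y in ~` U) ball y (n.+1%:R^-1 : R).
have -> : (setT `*` U : set (Omega * E)) = \bigcup_n (setT `*` C n).
  apply/seteqP; split=> -[w x] /=; last first.
    move=> [n _] [_ Cx]; split=> //; apply: contrapT => Ux; apply: Cx.
    by exists x => //; apply: ballxx; rewrite invr_gt0.
  move=> [_ Ux]; have /nbhs_ballP[r /= r0 rU] : nbhs x U by exact: open_nbhs_nbhs.
  have [n _ h] := near_infty_natSinv_lt (PosNum r0).
  exists n => //; split=> // -[y Uy yx]; apply: Uy; apply: rU.
  by apply: ball_sym; apply: le_ball yx; apply: ltW; exact: (h n (leqnn n)).
apply: suslin_bigcup => [|n].
  by rewrite -setXTT; apply: closed_rectangle => //; exact: closedT.
apply: suslin_self; apply: closed_rectangle => //; apply: open_closedC.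
by apply: bigcup_open => y _; exact: ball_open.
Qed.

Lemma measurable_prod_suslin (M : set (Omega * g_sigma_algebraType (@open E))) :
  measurable M -> suslin closed_rectangles (M : set (Omega * E)).
Proof.
have R0 : closed_rectangles set0.
  by rewrite -(@setX0 Omega E setT); apply: closed_rectangle => //; exact: closed0.
have RT : closed_rectangles setT.
  by rewrite -setXTT; apply: closed_rectangle => //; exact: closedT.
have [sa0 saC saU] := sigma_algebra_bisuslin R0 RT.
suff h : (measurable : set (set (Omega * g_sigma_algebraType (@open E)))) `<=`
    [set B | suslin closed_rectangles B /\ suslin closed_rectangles (~` B)].
  by move=> /h[].
apply: smallest_sub; first exact: sigma_algebra_bisuslin.
move=> _ [[A mA <-]|[U mU <-]].
- split; apply: suslin_self.
    by rewrite setTI -setXT; apply: closed_rectangle => //; exact: closedT.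
  rewrite setTI preimage_setC -setXT; apply: closed_rectangle; last exact: closedT.
  exact: measurableC.
- suff : <<s @open E >> `<=` [set U | suslin closed_rectangles (setT `*` U) /\
      suslin closed_rectangles (setT `*` (~` U))].
    by move=> /(_ U mU) /=; rewrite !setTX setTI preimage_setC.
  apply: smallest_sub; last first.
    move=> V oV; split; first exact: suslin_open_cylinder.
    by apply: suslin_self; apply: closed_rectangle => //; exact: open_closedC.
  split=> [|V [SV SCV]|V hV] /=.
  + by rewrite setX0 setC0 setXTT; split; exact: suslin_self.
  + by rewrite setTD setCK.
  + rewrite setC_bigcup !setTX preimage_bigcup preimage_bigcap; split.
      by apply: suslin_bigcup => // i; rewrite -setTX; have [] := hV i.
    by apply: suslin_bigcap => i; rewrite -setTX; have [] := hV i.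
Qed.

Variable e : nat -> E.
Hypothesis e_dense : forall x (r : R), 0 < r -> exists n, `|x - e n| < r.

(** The new sequence codes a witness s together with the indices m k of points
    of e within 1 / (k + 1) of x. The point x then becomes redundant: if for
    every n some point satisfies the first n closed conditions and is close to
    the first n points e (m k), such points form a Cauchy sequence, and its
    limit satisfies all conditions. *)
Lemma suslin_projection (M : set (Omega * E)) : suslin closed_rectangles M ->
  suslin measurable [set w | exists x, M (w, x)].
Proof.
move=> [S [rS /choice[N hN] ME]].
have /choice[r hr] : forall B : set (Omega * E), exists ac : set Omega * set E,
    closed_rectangles B -> [/\ measurable ac.1, closed ac.2 & B = ac.1 `*` ac.2].
  move=> B; have [[A [C h]]|nB] := pselect (closed_rectangles B).
    by exists (A, C).
  by exists (set0, set0).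
pose F n s := (r (S n s)).1; pose C n s := (r (S n s)).2.
have SE n s : S n s = F n s `*` C n s by have [] := hr _ (rS n s).
pose lft (t : nat -> nat) k := (unpair (t k)).1.
pose rgt (t : nat -> nat) k := (unpair (t k)).2.
pose Q n t x := forall k, (k <= n)%N ->
  C k (lft t) x /\ `|x - e (rgt t k)| <= k.+1%:R^-1.
exists (fun n t => if `[< exists x, Q n t x >] then F n (lft t) else set0).
split=> [n t|n|].
- by case: ifP => // _; have [] := hr _ (rS n (lft t)).
- exists (\max_(k < n.+1) N k + n.+1)%N => s t st.
  have hS k : (k <= n)%N -> S k (lft s) = S k (lft t).
    move=> kn; apply: hN => j jN; rewrite /lft st//.
    apply: leq_trans jN _; apply: leq_trans (leq_addr _ _).
    by have := @leq_bigmax _ (fun k : 'I_n.+1 => N k) (Ordinal (kn : (k < n.+1)%N)).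
  have hQ : Q n s = Q n t.
    apply/funext => x; apply/propext; split=> h k kn; have := h k kn;
      by rewrite /C hS// /rgt st// ltn_addl.
  by rewrite hQ /F hS.
- apply/seteqP; split=> w /=.
    move=> [x]; rewrite ME /= => -[s hs].
    have : forall k, exists m, `|x - e m| < k.+1%:R^-1.
      by move=> k; apply: e_dense; rewrite invr_gt0.
    move=> /choice[m hm]; exists (fun k => pickle (s k, m k)) => n.
    have -> : lft (fun k => pickle (s k, m k)) = s.
      by apply/funext => k; rewrite /lft unpairK.
    have hFC k : F k s w /\ C k s x by have := hs k; rewrite SE.
    case: ifPn => [_|/asboolPn]; first by have [] := hFC n.
    case; exists x => k _.
    have -> : lft (fun k => pickle (s k, m k)) = s.
      by apply/funext => j; rewrite /lft unpairK.
    by rewrite /rgt unpairK; split; [have [] := hFC k|exact: ltW (hm k)].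
  move=> [t ht].
  have : forall n, exists x, Q n t x.
    by move=> n; have := ht n; case: asboolP.
  move=> /choice[x hx].
  have Ft n : F n (lft t) w by have := ht n; case: ifPn => [/asboolP|].

  have xc : cvgn x.
    apply/cauchy_cvgP/cauchy_exP => eps eps0.
    have [n0 _ h] := near_infty_natSinv_lt (PosNum eps0).
    exists (e (rgt t n0)); exists n0 => // n /= n0n.
    have [_ le] := hx n n0 n0n; rewrite -ball_normE /= distrC.
    exact: le_lt_trans le (h n0 (leqnn n0)).
  have lx k : C k (lft t) (lim (x @ \oo)).
    have cC : closed (C k (lft t)) by have [] := hr _ (rS k (lft t)).
    apply: (@closed_cvg _ _ _ _ x (C k (lft t)) cC _ _ xc).
    by exists k => // n /= kn; have [] := hx n k kn.
  exists (lim (x @ \oo)); rewrite ME; exists (lft t) => n.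
  by rewrite SE.
Qed.

Variable P : probability Omega R.
Hypothesis P_complete : measure_is_complete P.

Lemma measurable_projection (M : set (Omega * g_sigma_algebraType (@open E))) :
  measurable M -> measurable [set w | exists x, M (w, x)].
Proof.
move=> mM; apply: (suslin_measurable P_complete); apply: suslin_projection.
exact: measurable_prod_suslin.
Qed.

End Projection.

(** * Functionals on a separable space and the weak topology *)

Section WeaklyCompact.
Context (R : realType) (E : normedModType R).

Lemma norm_convex_nonexpansive : convex_nonexpansive (fun x : E => `|x|).
Proof.
split=> [x y a b a0 b0 _|x y]; last exact: lerB_dist.
by apply: le_trans (ler_normD _ _) _; rewrite !normrZ !ger0_norm.
Qed.

(** Subgradients of the norm at the points of a dense sequence: the one at e n
    takes the value of the norm of e n at e n. *)
Lemma separating_sequence (e : nat -> E) :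
  (forall x (r : R), 0 < r -> exists n, `|x - e n| < r) ->
  exists f : nat -> dual_space E, forall x, (forall n, f n x = 0) -> x = 0.
Proof.
move=> ed; have cn := norm_convex_nonexpansive.
have /choice[f hf] := fun n => subgrad_dual (e n) ed cn.
exists f => x fx; apply/eqP; rewrite -normr_eq0; apply: contrapT => /negP x0.
have {}x0 : 0 < `|x| by rewrite lt_def x0 normr_ge0.
have [n xn] := ed x _ (divr_gt0 x0 (ltr0Sn _ 1) : 0 < `|x| / 2).
have := subgrad_le e (e n) (- e n) cn; rewrite subrr normr0.
have := subgrad_le e (e n) (e n - x) cn.
rewrite -!hf linearB linearN /= fx.
have := ler_normD (e n) (e n - x); have := ler_normD (x - e n) (e n).
rewrite subrK (distrC (e n) x) subr0 sub0r.
move: xn; lra.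
Qed.

Lemma dual_lin_comb (f : nat -> dual_space E) (a : nat -> R) n :
  exists u : dual_space E, forall x, u x = \sum_(i < n) a i * f i x.
Proof.
pose g x : R^o := \sum_(i < n) a i * (f i x : R).
have glin : linear g.
  move=> b x y; rewrite /g scaler_sumr -big_split/=; apply: eq_bigr => i _.
  by rewrite linearP mulrDr; congr (_ + _); rewrite /GRing.scale/= mulrCA.
pose gL : {linear E -> R^o} :=
  HB.pack g (@GRing.isLinear.Build R E R^o *:%R g glin).
have gc : continuous gL.
  apply: (@continuous_big R^o); first exact: add_continuous.
  move=> i _ x; apply: cvgMr; exact: dual_continuous.
by exists (Dual gc).
Qed.

Lemma weak_continuous (u : dual_space E) :
  continuous (u : weak_topology E -> R^o).
Proof.
move=> x; apply: cvg_trans (@initial_continuous E R^o u x); apply: cvg_app.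
exact: (@cvg_sup E (dual_space E) _ (nbhs (x : weak_topology E)) x _).1 cvg_id u.
Qed.

End WeaklyCompact.

(** * Separation from weakly compact convex sets *)

Section WeaklyCompactSeparation.
Context (R : realType) (E : normedModType R) (f : nat -> dual_space E).
Hypothesis f_separating : forall x, (forall n, f n x = 0) -> x = 0.
Variables (X : set E) (x : E).
Hypotheses (X_compact : weakly_compact X) (Xx : ~ X x).

(** Otherwise points y m of X agreeing with x on the first m functionals have a
    weak cluster point in X, which agrees with x on all of them. *)
Lemma weakly_compact_finite_separation : exists m, forall y, X y ->
  exists2 i, (i < m)%N & f i y <> f i x.
Proof.
apply: contrapT => /forallNP H.
have : forall m, exists y, X y /\ forall i, (i < m)%N -> f i y = f i x.
  move=> m; apply: contrapT => nex; apply: (H m) => y Xy; apply: contrapT => h.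
  apply: nex; exists y; split=> // i im; apply: contrapT => fi; apply: h.
  by exists i.
move=> /choice[y hy].
pose F : set_system (weak_topology E) := y @ \oo.
have FX : F X by exists 0%N => // n _; have [] := hy n.
have [p [Xp Fp]] := X_compact (_ : ProperFilter F) FX.
apply: Xx; suff -> : x = p by [].
apply/eqP; rewrite -subr_eq0; apply/eqP/f_separating => i; rewrite linearB /=.
apply/eqP; rewrite subr_eq0; apply: contrapT => /negP fxp.
have nb : nbhs (p : weak_topology E) (f i @^-1` [set r | r != f i x]).
  apply: (@weak_continuous R E (f i)); apply: open_nbhs_nbhs; split.
    by have := @open_neq R (f i x).
  by rewrite /= eq_sym.
have Fi : F [set z | f i z = f i x].
  by exists i.+1 => // n /= ni; have [_ /(_ i ni)] := hy n.
by have [z [/= ->]] := Fp _ _ Fi nb; rewrite eqxx.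
Qed.

Hypotheses (X_nonempty : X !=set0)
  (X_convex : convex_set (X : set (convex_lmodType E))).

Lemma weak_continuous_sum m (g : nat -> R -> R) : (forall i, continuous (g i)) ->
  {within (X : set (weak_topology E)),
    continuous (fun y : weak_topology E => \sum_(i < m) g i (f i y))}.
Proof.
move=> gc; apply: continuous_subspaceT.
apply: (@continuous_big R); first exact: add_continuous.
move=> i _ y; apply: (@continuous_comp (weak_topology E) R R (f i) (g i)).
  exact: weak_continuous.
exact: gc.
Qed.

(** The image of X under finitely many functionals is a compact convex set which
    avoids the image of x; its point nearest to the image of x gives the
    separating direction. *)
Lemma weakly_compact_separation : exists (a : nat -> R) m (S : R),
  0 < S /\ forall y, X y -> \sum_(i < m) a i * (f i x - f i y) >= S.
Proof.
have [m hm] := weakly_compact_finite_separation.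
pose g i (r : R) := (r - f i x) ^+ 2.
have gc i : continuous (g i).
  move=> r; apply: (@continuous_comp R R R (fun t => t - f i x) (fun t => t ^+ 2)).
    by apply: cvgB; [exact: cvg_id|exact: cvg_cst].
  exact: exprn_continuous.
have [y0 /set_mem Xy0 y0min] :=
  @compact_EVT_min (weak_topology E) R _ X X_nonempty X_compact
    (weak_continuous_sum (m := m) gc).
pose a i : R := f i x - f i y0.
exists a, m, (\sum_(i < m) a i ^+ 2); split.
  have [i im fi] := hm _ Xy0.
  rewrite (bigD1 (Ordinal im))//= ltr_wpDr//.
    by apply: sumr_ge0 => j _; exact: sqr_ge0.
  by rewrite exprn_even_gt0//= subr_eq0 eq_sym; apply/eqP.
move=> y Xy; pose b i : R := f i y - f i y0.
pose B := \sum_(i < m) a i * b i; pose Q := \sum_(i < m) b i ^+ 2.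
have Q0 : 0 <= Q by apply: sumr_ge0 => i _; exact: sqr_ge0.
(* minimality of y0 against the point at time t on the segment to y *)
have key (t : R) : 0 < t -> t <= 1 -> 2 * B <= t * Q.
  move=> t0 t1.
  have Xt : X (t *: y + (1 - t) *: y0).
    by have := X_convex (Itv01 (ltW t0) t1) (mem_set Xy) (mem_set Xy0); rewrite inE.
  have := y0min _ (mem_set Xt).
  have -> : \sum_(i < m) g i (f i (t *: y + (1 - t) *: y0)) =
      \sum_(i < m) a i ^+ 2 - t * (2 * B) + t * (t * Q).
    rewrite /B /Q !mulr_sumr -sumrB -big_split/=; apply: eq_bigr => i _.
    rewrite /g linearD !linearZ /= /a /b /GRing.scale/=; ring.
  have -> : \sum_(i < m) g i (f i y0) = \sum_(i < m) a i ^+ 2.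
    by apply: eq_bigr => i _; rewrite /g /a; ring.
  by move=> h; rewrite -(ler_pM2l t0); lra.
have B0 : B <= 0.
  rewrite leNgt; apply/negP => B0.
  have BQ : 0 < B + Q by rewrite ltr_wpDr.
  (* this time gives 2 B <= B Q / (B + Q) <= B *)
  have := key (B / (B + Q)) (divr_gt0 B0 BQ).
  rewrite ler_pdivrMr// mul1r lerDl => /(_ Q0).
  by rewrite mulrAC ler_pdivlMr//; nra.
have -> : \sum_(i < m) a i * (f i x - f i y) = \sum_(i < m) a i ^+ 2 - B.
  by rewrite /B -sumrB; apply: eq_bigr => i _; rewrite /a /b; ring.
by rewrite lerBrDl gerDr.
Qed.

(** The functionals are bounded on X, so the separation with margin S survives a
    small change of the coefficients. *)
Lemma weakly_compact_rational_separation : exists (q : seq rat) (r : R),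
  0 < r /\ forall y, X y ->
    \sum_(i < size q) ratr (nth 0 q i) * f i y + r <=
    \sum_(i < size q) ratr (nth 0 q i) * f i x.
Proof.
have [a [m [S [S0 hS]]]] := weakly_compact_separation.
pose g i (t : R) := `|f i x - t|.
have gc i : continuous (g i).
  move=> t; rewrite /g; apply: cvg_norm; apply: cvgB; [exact: cvg_cst|exact: cvg_id].
have [y1 _ y1max] :=
  @compact_EVT_max (weak_topology E) R _ X X_nonempty X_compact
    (weak_continuous_sum (m := m) gc).
pose M := \sum_(i < m) g i (f i y1).
have M0 : 0 <= M by apply: sumr_ge0 => i _; exact: normr_ge0.
pose eps := S / (2 * (M + 1)).
have eps0 : 0 < eps by rewrite divr_gt0// mulr_gt0// ltr_wpDl.
have : forall i, exists q : rat, `|ratr q - a i| < eps.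
  move=> i; have ai : a i < a i + eps by rewrite ltrDl.
  have [q] := rat_in_itvoo ai; rewrite in_itv/= => /andP[q1 q2].
  by exists q; rewrite gtr0_norm; lra.
move=> /choice[q hq]; exists (mkseq q m), (S / 2); split; first by rewrite divr_gt0.
move=> y Xy; rewrite size_mkseq addrC -lerBrDr -sumrB.
have -> : \sum_(i < m) (ratr (nth 0 (mkseq q m) i) * f i x
      - ratr (nth 0 (mkseq q m) i) * f i y) =
    \sum_(i < m) a i * (f i x - f i y) +
    \sum_(i < m) (ratr (q i) - a i) * (f i x - f i y).
  by rewrite -big_split/=; apply: eq_bigr => i _; rewrite nth_mkseq//; ring.
have h1 : - (eps * M) <= \sum_(i < m) (ratr (q i) - a i) * (f i x - f i y).
  have : `|\sum_(i < m) (ratr (q i) - a i) * (f i x - f i y)| <= eps * M.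
    apply: le_trans (ler_norm_sum _ _ _) _.
    apply: (@le_trans _ _ (eps * \sum_(i < m) g i (f i y))).
      rewrite mulr_sumr; apply: ler_sum => i _; rewrite normrM.
      by apply: ler_wpM2r => //; exact: ltW.
    by apply: ler_wpM2l (ltW eps0) _ _ _; apply: y1max; exact: mem_set.
  by rewrite ler_norml => /andP[].
have h2 : eps * M <= S / 2.
  have -> : S / 2 = eps * (M + 1) by rewrite /eps; field; rewrite gt_eqF// ltr_wpDl.
  by apply: ler_wpM2l (ltW eps0) _ _ _; rewrite lerDl.
have := hS y Xy; lra.
Qed.

End WeaklyCompactSeparation.

(** * Random half-spaces *)

Lemma dense_sequence (R : realType) (E : normedModType R) : separable E ->
  exists e : nat -> E, forall x (r : R), 0 < r -> exists n, `|x - e n| < r.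
Proof.
move=> [S /countable_injP[f finj] dS].
have /choice[e he] : forall n, exists x, (exists2 y, S y & f y = n) -> S x /\ f x = n.
  move=> n; have [[y Sy fy]|h] := pselect (exists2 y, S y & f y = n).
    by exists y.
  by exists 0.
exists e => x r r0.
have [|y [xy Sy]] := dS (ball x r) _ (ball_open x r).
  by exists x; exact: ballxx.
exists (f y); have [|Se fe] := he (f y); first by exists y.
have -> : e (f y) = y by apply: finj => //; exact: mem_set.
by move: xy; rewrite -ball_normE.
Qed.

Lemma weakly_compact_halfspaces (R : realType) (E : normedModType R)
    (f : nat -> dual_space E) (U : seq rat -> dual_space E) (X : set E) :
  (forall x, (forall n, f n x = 0) -> x = 0) ->
  (forall q x, U q x = \sum_(i < size q) ratr (nth 0 q i) * f i x) ->
  X !=set0 -> weakly_compact X -> convex_set (X : set (convex_lmodType E)) ->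
  X = \bigcap_n [set x : E | ((U (odflt [::] (unpickle n)) x : R)%:E <=
        support_function X (U (odflt [::] (unpickle n))))%E].
Proof.
move=> fs UE X0 cX vX; apply/seteqP; split=> [x Xx n _|x Hx] /=.
  by apply: ereal_sup_ubound; exists x.
apply: contrapT => Xx.
have [q [r [r0 h]]] := weakly_compact_rational_separation fs cX Xx X0 vX.
have := Hx (pickle q) I; rewrite pickleK /=.
have : (support_function X (U q) <= (U q x - r)%:E)%E.
  apply: ge_ereal_sup => _ [y Xy <-]; rewrite lee_fin lerBrDr !UE; exact: h.
by move=> le1 /le_trans/(_ le1); rewrite lee_fin; lra.
Qed.

(** The set where the distance is less than a is the projection of the part of
    the graph that lies over the ball of radius a. The dummy value [set 0] off G
    provides a nonempty convex set for every outcome. *)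
Lemma measurable_dist (R : realType) (E : completeNormedModType R)
    (d : measure_display) (Omega : measurableType d) (P : probability Omega R)
    (e : nat -> E) (X : Omega -> set E) (G : set Omega) (x : E) :
  (forall x (r : R), 0 < r -> exists n, `|x - e n| < r) ->
  measure_is_complete P -> random_set X -> measurable G ->
  (forall w, G w -> X w !=set0) ->
  measurable_fun setT (fun w => dist (if w \in G then X w else [set 0]) x).
Proof.
move=> ed cP rX mG GX; apply: measurable_fun_lt_ray => a.
have -> : [set w | dist (if w \in G then X w else [set 0]) x < a] =
    (G `&` [set w | exists y, ([set p | X p.1 p.2] `&` setT `*` ball x a) (w, y)])
    `|` (~` G `&` [set w | dist [set 0] x < a]).
  apply/seteqP; split=> w /=.
    case: ifPn => [/set_mem Gw|/negP Gw] h; last first.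
      by right; split=> // Gw'; apply: Gw; exact: mem_set.
    left; split=> //; have [c Xc xc] := (dist_ltP x a (GX _ Gw)).1 h.
    by exists c; split=> //; split=> //; rewrite -ball_normE.
  move=> [[Gw [y [Xy [_ xy]]]]|[Gw h]].
    rewrite mem_set//; apply/(dist_ltP x a (GX _ Gw)); exists y => //.
    by move: xy; rewrite -ball_normE.
  by rewrite memNset.
apply: measurableU; apply: measurableI => //.
- apply: (measurable_projection ed cP); apply: measurableI; first exact: rX.
  apply: measurableX => //; apply: sub_sigma_algebra.
  exact: ball_open.
- exact: measurableC.
- have [h|h] := boolP (dist [set 0] x < a).
    by rewrite (_ : [set _ | _] = setT)//; apply/seteqP; split.
  by rewrite (_ : [set _ | _] = set0)//; apply/seteqP; split=> w //= h'; rewrite h' in h.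
Qed.

Theorem theorem3p4 (R : realType) (E : completeNormedModType R)
    (E_separable : separable E)
    (d : measure_display) (Omega : measurableType d) (P : probability Omega R)
    (P_complete : measure_is_complete P)
    (X : Omega -> set E) (X_random : random_set X)
    (X_nonempty : {ae P, forall w, X w !=set0})
    (X_closed : {ae P, forall w, closed (X w)})
    (X_convex : {ae P, forall w, convex_set (X w : set (convex_lmodType E))}) :
  (exists zeta : nat -> Omega -> dual_space E,
     (forall n, random_dual_element (zeta n)) /\
     {ae P, forall w, X w = \bigcap_n [set x : E |
        ((zeta n w x : R)%:E <= support_function (X w) (zeta n w))%E]}) /\
  ({ae P, forall w, weakly_compact (X w)} ->
   exists D : set (dual_space E), countable D /\ total_set D /\
   exists u : nat -> dual_space E, (forall n, D (u n)) /\
     {ae P, forall w, X w = \bigcap_n [set x : E |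
        ((u n x : R)%:E <= support_function (X w) (u n))%E]}).
Proof.
have [e ed] := dense_sequence E_separable.
split.
  (* the construction runs on the measurable set G of full measure where X has
     the required properties, and on a dummy set elsewhere *)
  pose G := [set w | X w !=set0 /\ closed (X w) /\
                     convex_set (X w : set (convex_lmodType E))].
  have aeG : {ae P, forall w, G w}.
    by apply: filterS3 X_nonempty X_closed X_convex => w.
  have mG : measurable G by rewrite -(setCK G); apply/measurableC/P_complete.
  pose C w := if w \in G then X w else [set 0].
  have C0 w : C w !=set0.
    by rewrite /C; case: ifPn => [/set_mem[]//|_]; exists 0.
  have Cc w : convex_set (C w : set (convex_lmodType E)).
    rewrite /C; case: ifPn => [/set_mem[_ []]//|_] x y t.
    rewrite !inE => -> ->; exact: (@convmm R (convex_lmodType E) t (0 : E)).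
  have cd w := dist_convex_nonexpansive (C0 w) (Cc w).
  have /choice[zeta hz] : forall n, exists z : Omega -> dual_space E,
      forall w x, z w x = subgrad e (dist (C w)) (e n) x.
    by move=> n; have /choice[z hz] := fun w => subgrad_dual (e n) ed (cd w); exists z.
  exists zeta; split=> [n x|].
    rewrite (_ : (fun w => _) = (fun w => subgrad e (dist (C w)) (e n) x)); last first.
      by apply/funext => w; rewrite hz.
    apply: measurable_subgrad => // y.
    by apply: (measurable_dist y ed P_complete X_random mG) => w [].
  apply: filterS aeG => w Gw; have [X0 [cX vX]] := Gw.
  apply: (closed_convex_halfspaces ed X0 cX vX) => n x.
  by rewrite hz /C mem_set.
move=> X_compact; have [f fs] := separating_sequence ed.
have /choice[U UE] := fun q : seq rat =>
  dual_lin_comb f (fun i => ratr (nth 0 q i)) (size q).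
pose u n := U (odflt [::] (unpickle n)).
exists (range u); split; first exact: card_image_le.
split; last first.
  exists u; split; first by move=> n; exists n.
  apply: (filterS _ (filterI X_nonempty (filterI X_compact X_convex))) => w.
  by move=> [X0 [cX vX]]; exact: (weakly_compact_halfspaces fs UE).
move=> x y xy; apply: contrapT => H; apply: xy.
apply/eqP; rewrite -subr_eq0; apply/eqP/fs => n.
rewrite linearB /=; apply/eqP; rewrite subr_eq0; apply: contrapT => /negP/eqP fxy.
(* the list 0, ..., 0, 1 of length n + 1 yields the functional f n *)
pose k := pickle (rcons (nseq n 0) (1 : rat)).
apply: H; exists (u k); first by exists k.
have Un z : u k z = f n z.
  rewrite /u pickleK UE size_rcons size_nseq big_ord_recr/= nth_rcons size_nseq.
  rewrite ltnn eqxx rmorph1 mul1r big1 ?add0r// => i _.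
  by rewrite nth_rcons size_nseq ltn_ord nth_nseq ltn_ord rmorph0 mul0r.
by rewrite !Un.
Qed.
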